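(* For any graph $G$ with $n$ vertices and minimum degree $\delta$, (i) $\alpha_{ir}(G) + \gamma_{ir}(G) \leq n+1$ if $\delta = 0$, and $\alpha_{ir}(G) + \gamma_{ir}(G) \leq n$ if $\delta \geq 1$; (ii) $\alpha_{ir}(G)\, \gamma_{ir}(G) \leq \lfloor \frac{n+1}{2} \rfloor \lceil \frac{n+1}{2} \rceil$ if $\delta = 0$, and $\alpha_{ir}(G)\, \gamma_{ir}(G) \leq \lfloor \frac{n}{2} \rfloor \lceil \frac{n}{2} \rceil$ if $\delta \geq 1$; (iii) $\alpha_{ir}(G) + \gamma_{ir}(\bar{G}) \leq n+1$; (iv) $\alpha_{ir}(G)\, \gamma_{ir}(\bar{G}) \leq \lfloor \frac{n+1}{2} \rfloor \lceil \frac{n+1}{2} \rceil$. Moreover, the bounds are sharp: for each of these inequalities (including each of the two cases $\delta = 0$ and $\delta \geq 1$ in (i) and (ii)), there exist graphs for which equality holds.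
   Context: All graphs are finite, simple, undirected and have at least one vertex. $\bar{G}$ denotes the complement of $G$. An irregular independent set of $G$ is an independent set $A$ of $G$ such that any two distinct vertices in $A$ have different degrees in $G$; $\alpha_{ir}(G)$ is the size of a largest irregular independent set of $G$. $N(v)$ denotes the set of neighbours of a vertex $v$. A dominating set of $G$ is a set $D \subseteq V(G)$ such that every vertex in $V(G)\setminus D$ has a neighbour in $D$. An irregular dominating set of $G$ is a dominating set $D$ of $G$ such that $|N(u) \cap D| \neq |N(v) \cap D|$ for every two distinct vertices $u, v \in V(G) \setminus D$ (in particular, $V(G)$ is one); $\gamma_{ir}(G)$ is the size of a smallest irregular dominating set of $G$. *)

(* Defs.v *)
From mathcomp Require Import all_boot.

Set Implicit Arguments.
Unset Strict Implicit.
Unset Printing Implicit Defensive.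

Record sgraph := SGraph {
  vertex :> finType;
  edge : rel vertex;
  edge_sym : symmetric edge;
  edge_irrefl : irreflexive edge;
  vertex_gt0 : 0 < #|vertex|
}.

Section Graph.
Variable G : sgraph.
Implicit Types (A D : {set G}) (u v : G).

Definition compl_edge : rel G := fun u v => (u != v) && ~~ edge u v.

Lemma compl_edge_sym : symmetric compl_edge.
Proof. by move=> u v; rewrite /compl_edge eq_sym edge_sym. Qed.

Lemma compl_edge_irrefl : irreflexive compl_edge.
Proof. by move=> u; rewrite /compl_edge eqxx. Qed.

Definition compl : sgraph :=
  SGraph compl_edge_sym compl_edge_irrefl (vertex_gt0 G).

Definition nbr v : {set G} := [set u | edge v u].

Definition degree v : nat := #|nbr v|.

(* Every degree is < #|G| and G has a vertex, so the default value #|G| of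
   the iterated minimum is never attained. *)
Definition min_degree : nat := \big[minn/#|G|]_(v : G) degree v.

Definition independent A : bool :=
  [forall u in A, forall v in A, ~~ edge u v].

Definition irregular_independent A : bool :=
  independent A &&
  [forall u in A, forall v in A, (u != v) ==> (degree u != degree v)].

Definition alpha_ir : nat :=
  \max_(A : {set G} | irregular_independent A) #|A|.

Definition dominating D : bool :=
  [forall u in ~: D, exists v in D, edge u v].

Definition irregular_dominating D : bool :=
  dominating D &&
  [forall u in ~: D, forall v in ~: D,
     (u != v) ==> (#|nbr u :&: D| != #|nbr v :&: D|)].

(* Makes setT a legitimate starting point for the arg min in gamma_ir. *)
Lemma irregular_dominating_setT : irregular_dominating [set: G].
Proof.
by apply/andP; split; apply/forallP => u; apply/implyP; rewrite setCT inE.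
Qed.

Definition gamma_ir : nat :=
  #|[arg min_(D < [set: G] | irregular_dominating D) #|D|]|.

End Graph.

(* Main.v *)
(** Let A be a maximum irregular independent set. All neighbours of a vertex of A
lie outside A, so if A has no isolated vertex then its complement is an
irregular dominating set; A contains at most one isolated vertex, which can be
moved to the complement. In the complement graph A is a clique, and for u in A
the complement of A \ {u} dominates through u, a vertex v of A having
n - |A| - deg v + 1 neighbours there. Equality holds for K_1 and K_2, because both
parameters are positive. *)

Require Import Defs.
From mathcomp Require Import all_boot.
From mathcomp Require Import zify.

Set Implicit Arguments.
Unset Strict Implicit.
Unset Printing Implicit Defensive.

Section Bounds.
Variable G : sgraph.
Implicit Types (A B D : {set G}) (u v : G).

Lemma irregular_independentP A :
  reflect ({in A &, forall u v, ~~ edge u v} /\ {in A &, injective (@degree G)})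
          (irregular_independent A).
Proof.
apply: (iffP andP) => -[].
  move=> /forall_inP indA /forall_inP irrA; split=> u v uA vA.
    exact: (forall_inP (indA u uA)).
  by apply: contra_eq; exact/implyP/(forall_inP (irrA u uA)).
move=> indA injA; split; apply/forall_inP => u uA; apply/forall_inP => v vA.
  exact: indA.
by apply/implyP; apply: contra_neq; exact: injA.
Qed.

Lemma irregular_dominatingP D :
  reflect ((forall u, u \notin D -> exists2 v, v \in D & edge u v) /\
           {in ~: D &, injective (fun u => #|nbr u :&: D|)})
          (irregular_dominating D).
Proof.
apply: (iffP andP) => -[].
  move=> /forall_inP domD /forall_inP irrD; split=> [u uD|u v uD vD].
    by apply/exists_inP/domD; rewrite inE.
  by apply: contra_eq; exact/implyP/(forall_inP (irrD u uD)).
move=> domD injD; split; apply/forall_inP => u uD.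
  by apply/exists_inP/domD; rewrite inE in uD.
apply/forall_inP => v vD.
by apply/implyP; apply: contra_neq; exact: injD.
Qed.

Lemma irregular_independentS A B :
  B \subset A -> irregular_independent A -> irregular_independent B.
Proof.
move=> /subsetP sBA /irregular_independentP[indA injA].
apply/irregular_independentP.
by split=> u v /sBA uA /sBA vA; [exact: indA | exact: injA].
Qed.

Lemma irregular_independent1 v : irregular_independent [set v].
Proof.
apply/irregular_independentP.
by split=> x y /set1P-> /set1P->; rewrite ?edge_irrefl.
Qed.

Lemma alpha_ir_attained :
  exists2 A : {set G}, irregular_independent A & #|A| = alpha_ir G.
Proof.
have [v _] := card_gt0P (vertex_gt0 G).
(* A singleton qualifies, so the maximum is taken over a nonempty family and is attained, rather
   than being the default value 0. *)
have P_gt0 : 0 < #|@irregular_independent G|.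
  by apply/card_gt0P; exists [set v]; exact: irregular_independent1.
by have [A PA eqA] := eq_bigmax_cond (fun A : {set G} => #|A|) P_gt0; exists A.
Qed.

Lemma alpha_ir_gt0 : 0 < alpha_ir G.
Proof.
have [v _] := card_gt0P (vertex_gt0 G).
rewrite -[X in X <= _](cards1 v) /alpha_ir.
apply: (leq_bigmax_cond (F := fun A : {set G} => #|A|)).
exact: irregular_independent1.
Qed.

Lemma gamma_ir_le D : irregular_dominating D -> gamma_ir G <= #|D|.
Proof.
rewrite /gamma_ir; case: arg_minnP => [|D0 _]; last exact.
exact: irregular_dominating_setT.
Qed.

Lemma gamma_ir_gt0 : 0 < gamma_ir G.
Proof.
rewrite /gamma_ir; case: arg_minnP => [|D].
  exact: irregular_dominating_setT.
move=> /irregular_dominatingP[domD _] _.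
have [v _] := card_gt0P (vertex_gt0 G); apply/card_gt0P.
by have [vD|/domD[u uD _]] := boolP (v \in D); [exists v | exists u].
Qed.

Lemma min_degree_le v : min_degree G <= degree v.
Proof.
rewrite /min_degree; elim: index_enum (mem_index_enum v) => //= u s IHs.
rewrite inE big_cons geq_min => /predU1P[->|/IHs->]; first by rewrite leqnn.
by rewrite orbT.
Qed.

(** By independence, restricting a neighbourhood of a vertex of [A] to [~: A] loses nothing. The
    counts to be distinguished are then the degrees, and a positive degree supplies a dominating
    neighbour. *)
Lemma irregular_dominatingC A :
  irregular_independent A -> {in A, forall v, 0 < degree v} ->
  irregular_dominating (~: A).
Proof.
move=> /irregular_independentP[indA injA] degA.
have nbrA u : u \in A -> nbr u :&: ~: A = nbr u.
  move=> uA; apply/setIidPl/subsetP => v; rewrite !inE => uv.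
  by apply: contraTN uv; exact: indA.
apply/irregular_dominatingP; split=> [u|u v].
  rewrite inE negbK => uA; have /card_gt0P[v] := degA u uA.
  by rewrite -(nbrA u uA) !inE => /andP[uv vA]; exists v; rewrite ?inE.
by rewrite setCK => uA vA; rewrite !nbrA //; exact: injA.
Qed.

Lemma gamma_ir_leC A :
  irregular_independent A -> {in A, forall v, 0 < degree v} ->
  #|A| + gamma_ir G <= #|G|.
Proof.
move=> irrA degA; rewrite -(cardsC A) leq_add2l.
exact/gamma_ir_le/irregular_dominatingC.
Qed.

Lemma alpha_add_gamma_ir_le : alpha_ir G + gamma_ir G <= #|G| + 1.
Proof.
rewrite addn1; have [A irrA <-] := alpha_ir_attained.
have [/forall_inP degA|] := boolP [forall v in A, 0 < degree v].
  exact/leqW/gamma_ir_leC.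
rewrite negb_forall_in => /exists_inP[x xA]; rewrite -eqn0Ngt => /eqP degx.
(* Dropping the isolated vertex [x] from [A] costs one; this is the extra 1 in the bound. *)
rewrite (cardsD1 x) xA addSn ltnS.
have [_ injA] := irregular_independentP _ irrA.
apply: gamma_ir_leC => [|v].
  exact: irregular_independentS (subsetDl _ _) irrA.
(* A second isolated vertex of [A] would share the degree of [x], hence equal [x]. *)
rewrite in_setD1 lt0n => /andP[+ vA]; apply: contra_neq => degv.
by apply: injA => //; rewrite degv.
Qed.

Lemma alpha_add_gamma_ir_min_degree :
  0 < min_degree G -> alpha_ir G + gamma_ir G <= #|G|.
Proof.
move=> deg_gt0; have [A irrA <-] := alpha_ir_attained.
by apply: gamma_ir_leC => // v _; exact: leq_trans deg_gt0 (min_degree_le v).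
Qed.

End Bounds.

Section ComplementBounds.
Variable G : sgraph.
Implicit Types (A : {set G}) (u : G).

Lemma irregular_dominating_compl A u :
  irregular_independent A -> u \in A ->
  @irregular_dominating (compl G) (~: (A :\ u)).
Proof.
move=> /irregular_independentP[indA injA] uA.
apply/(@irregular_dominatingP (compl G)); split=> [v|v w].
  rewrite inE negbK in_setD1 => /andP[vNu vA]; exists u; rewrite ?inE ?eqxx //.
  by rewrite /edge /= /compl_edge vNu indA.
(* All [G]-neighbours of [x] lie outside [A :\ u], and the other vertices outside it are the
   complement-neighbours of [x] there. The two counts have a sum independent of [x], so equal
   complement counts force equal degrees. *)
have nbrE x : x \in A :\ u ->
    #|@nbr (compl G) x :&: ~: (A :\ u)| + degree x = #|~: (A :\ u)|.
  rewrite in_setD1 => /andP[xNu xA].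
  rewrite -(cardsID (nbr x)) addnC; congr (_ + _).
    rewrite setIC; apply/esym/eq_card => y; rewrite !inE.
    by case xy: (edge x y) => //=; rewrite (contraTF (indA x y xA) xy) andbF.
  apply: eq_card => y; rewrite !inE /edge /= /compl_edge.
  by case: eqVneq => [<-|_]; rewrite ?xNu ?xA //= andbC.
rewrite setCK => vA wA eq_vw.
apply: injA; [by case/setD1P: vA | by case/setD1P: wA |].
apply/eqP; rewrite -(eqn_add2l #|@nbr (compl G) v :&: ~: (A :\ u)|) nbrE //.
by rewrite eq_vw nbrE.
Qed.

Lemma alpha_add_gamma_ir_compl : alpha_ir G + gamma_ir (compl G) <= #|G| + 1.
Proof.
have [A irrA cardA] := alpha_ir_attained G.
have /card_gt0P[u uA] : 0 < #|A| by rewrite cardA alpha_ir_gt0.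
(* The vertex [u] is counted both in [A] and in the dominating set, whence the bound [#|G| + 1]. *)
rewrite -cardA -(cardsC (A :\ u)) [in leqLHS](cardsD1 u) uA addnC addnCA.
rewrite [leqRHS]addnC leq_add2l [leqLHS]addnC leq_add2l.
exact/(@gamma_ir_le (compl G))/irregular_dominating_compl.
Qed.

End ComplementBounds.

Lemma leq_mul_halves a b m : a + b <= m -> a * b <= m./2 * uphalf m.
Proof.
wlog le_ab : a b / a <= b.
  move=> wlog_ab; case: (leqP a b) => [/wlog_ab //|/ltnW /wlog_ab].
  by rewrite addnC mulnC.
move=> le_m; have le_a : a <= m./2.
  by rewrite geq_half_double -addnn (leq_trans _ le_m) ?leq_add2l.
have le_up : m./2 <= uphalf m by rewrite uphalf_half leq_addl.
have def_m : m./2 + uphalf m = m.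
  by rewrite addnC uphalf_half -addnA addnn odd_double_half.
(* With h = [m./2] and k = [uphalf m], a * b <= a * (h + k - a) = h * k - (h - a) * (k - a), and a
   <= h <= k. *)
nia.
Qed.

Definition complete_edge n : rel 'I_n := fun u v => u != v.

Lemma complete_edge_sym n : symmetric (@complete_edge n).
Proof. by move=> u v; rewrite /complete_edge eq_sym. Qed.

Lemma complete_edge_irrefl n : irreflexive (@complete_edge n).
Proof. by move=> u; rewrite /complete_edge eqxx. Qed.

Lemma card_ord_gt0 n : 0 < #|'I_n.+1|.
Proof. by rewrite card_ord. Qed.

(** The index is shifted to keep the vertex set nonempty: this is the complete graph on [n.+1]
    vertices. *)
Definition complete n : sgraph :=
  SGraph (@complete_edge_sym n.+1) (@complete_edge_irrefl n.+1) (card_ord_gt0 n).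

Lemma degree_complete n (v : complete n) : degree v = n.
Proof.
rewrite -[RHS]/n.+1.-1 -[in RHS](card_ord n.+1) -(cardsC1 v).
by apply: eq_card => u; rewrite !inE eq_sym.
Qed.

Lemma min_degree_complete n : min_degree (complete n) = n.
Proof.
apply/eqP; rewrite eqn_leq.
have := min_degree_le (ord0 : complete n); rewrite degree_complete => -> /=.
(* Being at least [n] is preserved by [minn] and holds for the default value, here [n.+1]. *)
rewrite /min_degree; elim/big_ind: _ => [|a b|v _]; last by rewrite degree_complete.
  by rewrite card_ord.
by rewrite leq_min => -> ->.
Qed.

(** Lets the upper bounds themselves evaluate the parameters of the extremal graphs. *)
Lemma add_eq2_pos a b : 0 < a -> 0 < b -> a + b <= 2 -> a = 1 /\ b = 1.
Proof. by case: a b => [|[|a]] [|[|b]] //; rewrite ?addnS ?addSn. Qed.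

Theorem theorem5p1 :
  (forall (G : sgraph) (n delta : nat), #|G| = n -> min_degree G = delta ->
    [/\ (delta = 0 -> alpha_ir G + gamma_ir G <= n + 1) /\
        (1 <= delta -> alpha_ir G + gamma_ir G <= n),
        (delta = 0 ->
           alpha_ir G * gamma_ir G <= (n + 1)./2 * uphalf (n + 1)) /\
        (1 <= delta -> alpha_ir G * gamma_ir G <= n./2 * uphalf n),
        alpha_ir G + gamma_ir (compl G) <= n + 1
      & alpha_ir G * gamma_ir (compl G) <= (n + 1)./2 * uphalf (n + 1)])
  /\
  [/\ (exists G : sgraph,
         min_degree G = 0 /\ alpha_ir G + gamma_ir G = #|G| + 1) /\
      (exists G : sgraph,
         1 <= min_degree G /\ alpha_ir G + gamma_ir G = #|G|),
      (exists G : sgraph,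
         min_degree G = 0 /\
         alpha_ir G * gamma_ir G = (#|G| + 1)./2 * uphalf (#|G| + 1)) /\
      (exists G : sgraph,
         1 <= min_degree G /\
         alpha_ir G * gamma_ir G = #|G|./2 * uphalf #|G|),
      (exists G : sgraph, alpha_ir G + gamma_ir (compl G) = #|G| + 1)
    & (exists G : sgraph,
         alpha_ir G * gamma_ir (compl G) = (#|G| + 1)./2 * uphalf (#|G| + 1))].
Proof.
split=> [G n delta <- <-|].
  have le_c := alpha_add_gamma_ir_compl G.
  split; [split|split| |] => //; try by move=> _; exact: alpha_add_gamma_ir_le.
  - exact: alpha_add_gamma_ir_min_degree.
  - by move=> _; exact/leq_mul_halves/alpha_add_gamma_ir_le.
  - by move=> /alpha_add_gamma_ir_min_degree; exact: leq_mul_halves.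
  - exact: leq_mul_halves.
have K1 : #|complete 0| = 1 := card_ord 1.
have K2 : #|complete 1| = 2 := card_ord 2.
have [a1 g1] : alpha_ir (complete 0) = 1 /\ gamma_ir (complete 0) = 1.
  apply: (add_eq2_pos (alpha_ir_gt0 _) (gamma_ir_gt0 _)).
  by have := alpha_add_gamma_ir_le (complete 0); rewrite K1.
have [_ c1] : alpha_ir (complete 0) = 1 /\ gamma_ir (compl (complete 0)) = 1.
  apply: (add_eq2_pos (alpha_ir_gt0 _) (gamma_ir_gt0 _)).
  by have := alpha_add_gamma_ir_compl (complete 0); rewrite K1.
(* Here the minimum degree is 1, so the sharper bound by the order, 2, applies. *)
have [a2 g2] : alpha_ir (complete 1) = 1 /\ gamma_ir (complete 1) = 1.
  apply: (add_eq2_pos (alpha_ir_gt0 _) (gamma_ir_gt0 _)).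
  rewrite -[leqRHS]K2; apply: alpha_add_gamma_ir_min_degree.
  by rewrite min_degree_complete.
split.
- by split; [exists (complete 0) | exists (complete 1)];
    rewrite min_degree_complete ?K1 ?K2 ?a1 ?g1 ?a2 ?g2.
- by split; [exists (complete 0) | exists (complete 1)];
    rewrite min_degree_complete ?K1 ?K2 ?a1 ?g1 ?a2 ?g2.
- by exists (complete 0); rewrite K1 a1 c1.
- by exists (complete 0); rewrite K1 a1 c1.
Qed.
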